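(* Let $G=(U,V,E)$ be a finite bipartite graph and $F\subseteq E$. Then $G$ has a 2-chain subgraph cover $(G_1,G_2)$ such that $G_1$ has no edges in $F$ if and only if the set $E_c$ of committed edges of $G$ has an $(A,C)$-free bipartition.
   Context: Let $\hat{E}=\{uv: u\in U,\ v\in V,\ uv\notin E\}$. A chain graph is a bipartite graph with no induced $2K_2$. A 2-chain subgraph cover of $G$ is a pair $(G_1,G_2)$ with $G_i=(U,V,E_i)$, $E_i\subseteq E$, each $G_i$ a chain graph, and $E_1\cup E_2=E$. Two edges $u_1v_1,u_2v_2\in E$ ($u_i\in U$, $v_i\in V$) are in conflict in $G$ if $u_1v_2\notin E$ and $u_2v_1\notin E$ (i.e. the four vertices induce a $2K_2$). An edge of $E$ is committed if it is in conflict with some other edge of $E$; $E_c$ denotes the set of committed edges. A bipartition of $E_c$ is a pair $(E_r,E_b)$ with $E_r\cap E_b=\emptyset$, $E_r\cup E_b=E_c$, and $F\cap E_c\subseteq E_b$. Such a bipartition is $(A,C)$-free if there are no $u_1,u_2\in U$, $v_1,v_2\in V$ forming any of the configurations: $(A_1)$: $u_1v_1,u_2v_2\in E_r$ and $u_1v_2,u_2v_1\in\hat{E}$; $(A_2)$: $u_1v_1,u_2v_2\in E_b$ and $u_1v_2,u_2v_1\in\hat{E}$; $(C)$: $u_1v_1,u_2v_2\in E_r$, $u_1v_2\in\hat{E}$ and $u_2v_1\in F$. *)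

(* Defs.v *)
(* A finite bipartite graph G = (U,V,E) is given by two
   finite types U, V (the sides) and an edge set E : {set U * V}. *)
From mathcomp Require Import all_boot.
Set Implicit Arguments. Unset Strict Implicit. Unset Printing Implicit Defensive.

Section Defs.
Variables (U V : finType).

Definition nonedges (E : {set U * V}) : {set U * V} := ~: E.

Definition chain_graph (Ei : {set U * V}) : Prop :=
  ~ exists (u1 u2 : U) (v1 v2 : V),
      [/\ (u1, v1) \in Ei, (u2, v2) \in Ei, (u1, v2) \notin Ei & (u2, v1) \notin Ei].

Definition two_chain_cover (E E1 E2 : {set U * V}) : Prop :=
  [/\ E1 \subset E, E2 \subset E, chain_graph E1, chain_graph E2 & E1 :|: E2 = E].

Definition in_conflict (E : {set U * V}) (e f : U * V) : Prop :=
  [/\ e \in E, f \in E, (e.1, f.2) \notin E & (f.1, e.2) \notin E].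

Definition committed (E : {set U * V}) : {set U * V} :=
  [set e in E | [exists f, (f != e) && [&& f \in E, (e.1, f.2) \notin E & (f.1, e.2) \notin E]]].

Definition bipartition_Ec (E F Er Eb : {set U * V}) : Prop :=
  [/\ Er :&: Eb = set0, Er :|: Eb = committed E & F :&: committed E \subset Eb].

Definition AC_free (E F Er Eb : {set U * V}) : Prop :=
  forall (u1 u2 : U) (v1 v2 : V),
    [/\ ~ [/\ (u1, v1) \in Er, (u2, v2) \in Er,
              (u1, v2) \in nonedges E & (u2, v1) \in nonedges E],
        ~ [/\ (u1, v1) \in Eb, (u2, v2) \in Eb,
              (u1, v2) \in nonedges E & (u2, v1) \in nonedges E]
      & ~ [/\ (u1, v1) \in Er, (u2, v2) \in Er,
              (u1, v2) \in nonedges E & (u2, v1) \in F]].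

End Defs.

(* Main.v *)
(** Call the edges of [Er] red, and the non-red edges of [E] blue.

    A set [X] of edges lies in a chain graph avoiding [N] as soon as no closed
    walk alternates between [X] and [N]: rank the vertices of [U] by
    reachability.  So the red edges must have no closed alternating walk with
    the non-edges and [F], and the blue ones none with the non-edges.

    (1) Under (A) and (C), a passage through [F] between two red edges can be
    replaced by red edges and non-edges only, so it suffices to treat non-edges.

    (2) Under (A), a shortest closed walk alternating between edges of one
    colour and non-edges uses three edges, and then lies on an induced 6-cycle
    whose edges alternate in colour.

    (3) These 6-cycles are removed by recolouring.  For a non-edge [(a, b)],
    invert the colours of all committed edges [xy] such that [xb] and [ay] both
    have the colour opposite to that of [xy].  This preserves (A) and (C), makes
    the condition fail for every [xy] at [(a, b)], and does not make it true
    anywhere at a non-edge where it failed everywhere before.  Doing this for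
    all non-edges one after the other leaves no bicoloured 6-cycle. *)
Require Import Defs.
From mathcomp Require Import all_boot.
Set Implicit Arguments. Unset Strict Implicit. Unset Printing Implicit Defensive.

(** * Chain graphs containing one relation and avoiding another *)

Section ChainExtension.
Variables (U V : finType) (X N : U -> V -> bool) (W : U -> V -> Prop).
Hypothesis sXW : forall u v, X u v -> W u v.
Hypothesis W_comp : forall u1 v1 u2 v2, W u1 v1 -> N u2 v1 -> W u2 v2 -> W u1 v2.
Hypothesis W_disj : forall u v, W u v -> N u v -> False.

(** The properties of [W] make [step] acyclic, so [rank] strictly drops along it. In the graph built
    here the neighbours of each [v] form an up-set for [rank], and up-sets are nested. An [N] pair
    in it would be a step that fails to lower [rank]. *)
Lemma chain_extension : exists H : {set U * V},
  [/\ chain_graph H, forall u v, X u v -> (u, v) \in H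
    & forall u v, (u, v) \in H -> ~~ N u v].
Proof.
pose step : rel U := fun u u' => [exists v, X u v && N u' v].
have path_walk u p u' : path step u p -> step (last u p) u' ->
    exists2 v, W u v & N u' v.
  elim: p u => [|w p IHp] u /=; first by move=> _ /existsP[v /andP[/sXW]]; exists v.
  case/andP=> /existsP[v /andP[Xuv Nwv]] wp /(IHp _ wp)[v' Wwv' Nv'].
  by exists v' => //; apply: W_comp Nwv Wwv'; apply: sXW.
pose rank u := #|connect step u|.
have rank_step u u' : step u u' -> rank u' < rank u.
  move=> uu'; apply/proper_card/properP; split.
    by apply/subsetP => w; apply: connect_trans; apply: connect1.
  exists u; first exact: connect0.
  apply/negP=> /connectP[p u'p lastp].
  have [|v Wv Nv] := path_walk u' p u' u'p; first by rewrite -lastp.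
  exact: W_disj Wv Nv.
exists [set e | [exists u', X u' e.2 && (rank u' <= rank e.1)]]; split.
- case=> u1 [u2 [v1 [v2 []]]]; rewrite !inE /=.
  case/existsP=> w1 /andP[X1 r1] /existsP[w2 /andP[X2 r2]] n12 /negP[].
  apply/existsP; exists w1; rewrite X1 /=.
  case: (leqP (rank u1) (rank u2)) => [|/ltnW] le12; first exact: leq_trans le12.
  case/existsP: n12; exists w2; rewrite X2; exact: leq_trans le12.
- by move=> u v Xuv; rewrite inE; apply/existsP; exists u; rewrite Xuv /=.
- move=> u v; rewrite inE => /existsP[w /andP[Xw le_wu]]; apply/negP => Nuv.
  have: rank u < rank w by apply: rank_step; apply/existsP; exists v; rewrite Xw.
  by rewrite ltnNge le_wu.
Qed.

End ChainExtension.

(** * Red-blue colourings and their recolouring at a non-edge *)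

Section Colouring.
Variables (U V : finType) (E F : U -> V -> bool).
Hypothesis sFE : forall u v, F u v -> E u v.

Definition conflicts u1 v1 u2 v2 :=
  [/\ E u1 v1, E u2 v2, ~~ E u1 v2 & ~~ E u2 v1].

Definition has_conflict u v :=
  [exists u', exists v', [&& E u v, E u' v', ~~ E u v' & ~~ E u' v]].

Lemma has_conflictP u v :
  reflect (exists u' v', conflicts u v u' v') (has_conflict u v).
Proof.
apply: (iffP existsP) => [[u' /existsP[v' /and4P C]]|[u' [v' C]]].
  by exists u', v'.
by exists u'; apply/existsP; exists v'; apply/and4P.
Qed.

Lemma conflicts_sym u1 v1 u2 v2 : conflicts u1 v1 u2 v2 -> conflicts u2 v2 u1 v1.
Proof. by case. Qed.

Lemma conflictsW u1 v1 u2 v2 : conflicts u1 v1 u2 v2 -> has_conflict u1 v1.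
Proof. by move=> C; apply/has_conflictP; exists u2, v2. Qed.

(** Only the red class is stored: every other edge, committed or not, is blue. Both (A) clauses
    merge into one equation. *)
Record valid (R : U -> V -> bool) : Prop := Valid {
  valid_conflict : forall u v, R u v -> has_conflict u v;
  valid_A : forall u1 v1 u2 v2, conflicts u1 v1 u2 v2 -> R u1 v1 = ~~ R u2 v2;
  valid_F : forall u v, F u v -> ~~ R u v;
  valid_C : forall u1 v1 u2 v2,
    R u1 v1 -> R u2 v2 -> ~~ E u1 v2 -> F u2 v1 -> False }.

Definition twisted (R : U -> V -> bool) a b x y :=
  [&& has_conflict x y, E x b, E a y, R x b != R x y & R a y != R x y].

Definition flip R a b x y := R x y (+) twisted R a b x y.

Section Valid.
Variable R : U -> V -> bool.
Hypothesis vR : valid R.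

Lemma valid_edge u v : R u v -> E u v.
Proof. by move/(valid_conflict vR)/has_conflictP => [? [? []]]. Qed.

Lemma same_colour u1 v1 u2 v2 :
  E u1 v1 -> E u2 v2 -> R u1 v1 = R u2 v2 -> ~~ E u1 v2 -> E u2 v1.
Proof.
move=> e1 e2 eqR n12; apply: contraT => n21.
have /(valid_A vR) : conflicts u1 v1 u2 v2 by [].
by rewrite eqR; case: (R u2 v2).
Qed.

Lemma twisted_col a b x : twisted R a b x b = false.
Proof. by rewrite /twisted eqxx !andbF. Qed.

Lemma twisted_row a b y : twisted R a b a y = false.
Proof. by rewrite /twisted eqxx !andbF. Qed.

(** The edge [sw] has the colour of [xb] and [ay], so [sb] and [aw] must be edges, in conflict with
    [ay] and [xb] respectively. Conflicting edges are thus inverted together, which preserves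
    (A). *)
Lemma twistedW a b x y s w : ~~ E a b ->
  conflicts x y s w -> twisted R a b x y -> twisted R a b s w.
Proof.
move=> nab cf /and5P[_ exb eay cxb cay]; have [exy esw nxw nsy] := cf.
have csw := valid_A vR cf.
have esb : E s b by apply: (same_colour exb esw) => //; move: cxb; rewrite csw; do 2?case: (R _ _).
have eaw : E a w by apply: (same_colour esw eay) => //; move: cay; rewrite csw; do 2?case: (R _ _).
apply/and5P; split=> //; first exact: conflictsW (conflicts_sym cf).
  have /(valid_A vR)-> : conflicts s b a y by [].
  by move: cay; rewrite csw; do 2?case: (R _ _).
have /(valid_A vR)-> : conflicts a w x b by [].
by move: cxb; rewrite csw; do 2?case: (R _ _).
Qed.

Lemma twisted_conflicts a b x y s w : ~~ E a b ->
  conflicts x y s w -> twisted R a b x y = twisted R a b s w.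
Proof.
by move=> nab cf; apply/idP/idP; apply: twistedW => //; apply: conflicts_sym.
Qed.

Lemma flip_valid a b : ~~ E a b -> valid (flip R a b).
Proof.
move=> nab.
have twisted_flip x y : flip R a b x y -> twisted R a b x y -> R x b /\ R a y.
  rewrite /flip => Rxy T; have /and5P[_ _ _] := T; move: Rxy; rewrite T.
  by case: (R x y) => // _; do 2?case: (R _ _).
have untwisted_flip x y : flip R a b x y -> ~~ twisted R a b x y -> R x y.
  by rewrite /flip => + /negPf T; rewrite T addbF.
have vRC := valid_C vR; have vRE := valid_edge.
split=> [u v|u1 v1 u2 v2 cf|u v Fuv|u1 v1 u2 v2 f1 f2 n12 F21].
- case T: (twisted R a b u v); first by case/and5P: T.
  by rewrite /flip T addbF; apply: (valid_conflict vR).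
- rewrite /flip (twisted_conflicts nab cf) (valid_A vR cf).
  by case: (R _ _); case: (twisted _ _ _ _ _).
- apply/negP => f; case T: (twisted R a b u v).
    by have [Rub Rav] := twisted_flip _ _ f T; apply: vRC Rav Rub nab Fuv.
  by move: f; rewrite /flip T addbF (negPf (valid_F vR Fuv)).
- case T1: (twisted R a b u1 v1); case T2: (twisted R a b u2 v2).
  + have [R1b Ra1] := twisted_flip _ _ f1 T1.
    have [R2b Ra2] := twisted_flip _ _ f2 T2.
    have /(valid_A vR) : conflicts u1 b a v2 by split=> //; apply: vRE.
    by rewrite R1b Ra2.
  (* Only [u1 v1] was inverted. Since [a v1] was red, (C) makes [u2 b] blue and [a v2] an edge, blue
     by its conflict with [u1 b]; hence [u2 v2] was twisted too. The next case is symmetric. *)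
  + have [R1b Ra1] := twisted_flip _ _ f1 T1.
    have R2 := untwisted_flip _ _ f2 (negbT T2).
    have e2b : E u2 b by apply: (same_colour (vRE _ _ R1b) (vRE _ _ R2)); rewrite ?R1b ?R2.
    have r2b : ~~ R u2 b by apply/negP => R2b; apply: vRC Ra1 R2b nab F21.
    have ea2 : E a v2 by apply: contraT => na2; case: (vRC _ _ _ _ Ra1 R2 na2 F21).
    have /(valid_A vR) ra2 : conflicts a v2 u1 b by split=> //; apply: vRE.
    move: T2; rewrite /twisted (valid_conflict vR R2) e2b ea2 R2 ra2 R1b.
    by rewrite (negPf r2b).
  + have [R2b Ra2] := twisted_flip _ _ f2 T2.
    have R1 := untwisted_flip _ _ f1 (negbT T1).
    have ea1 : E a v1 by apply: (same_colour (vRE _ _ R1) (vRE _ _ Ra2)); rewrite ?R1 ?Ra2.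
    have ra1 : ~~ R a v1 by apply/negP => Ra1; apply: vRC Ra1 R2b nab F21.
    have e1b : E u1 b by apply: contraT => n1b; case: (vRC _ _ _ _ R1 R2b n1b F21).
    have /(valid_A vR) r1b : conflicts u1 b a v2 by split=> //; apply: vRE.
    move: T1; rewrite /twisted (valid_conflict vR R1) e1b ea1 R1 r1b Ra2.
    by rewrite (negPf ra1).
  + by apply: vRC n12 F21; apply: untwisted_flip; rewrite ?T1 ?T2.
Qed.

Lemma flip_untwisted a b x y : ~~ twisted (flip R a b) a b x y.
Proof.
apply/negP; rewrite {1}/twisted /flip twisted_col twisted_row !addbF.
case T: (twisted R a b x y).
  by case/and5P: T => _ _ _ + + /and5P[_ _ _]; do 3!case: (R _ _).
by rewrite addbF -/(twisted R a b x y) T.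
Qed.

(** If [xy] is twisted at [(c, d)] after the flip, then one of [xy], [xb], [ay] was already twisted
    there before it. *)
Lemma flip_stays_untwisted a b c d : ~~ E a b -> ~~ E c d ->
  (forall x y, ~~ twisted R c d x y) ->
  forall x y, ~~ twisted (flip R a b) c d x y.
Proof.
move=> nab ncd T0 x y; apply/negP => T'xy; have vR' := flip_valid nab.
have vA := valid_A vR.
have [hxy exd ecy cxd ccy] := and5P T'xy.
have [s [w cf]] := has_conflictP _ _ hxy; have [exy esw nxw nsy] := cf.
have T0F x' y' s' w' : conflicts x' y' s' w' -> E x' d -> E c y' ->
    R x' d != R x' y' -> R c y' != R x' y' -> False.
  move=> cf' e1 e2 c1 c2; have /negP[] := T0 x' y'.
  by apply/and5P; split=> //; apply: conflictsW cf'.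
have /andP[esd ecw] : E s d && E c w.
  have nRsw := valid_A vR' cf.
  apply/andP; split.
  - apply: contraT => nsd.
    have /(valid_A vR') : conflicts x d s w by [].
    by move: cxd; rewrite nRsw; do 2?case: (flip _ _ _ _ _).
  - apply: contraT => ncw.
    have /(valid_A vR') : conflicts c y s w by [].
    by move: ccy; rewrite nRsw; do 2?case: (flip _ _ _ _ _).
have cfxd : conflicts x d c w by [].
have cfcy : conflicts c y s d by [].
case Txd: (twisted R a b x d).
  have /and5P[_ exb ead rxb rad] := Txd.
  have /and5P[_ ecb eaw rcb raw] := twistedW nab cfxd Txd.
  apply: (T0F x b a w) => //; first by rewrite eq_sym.
  by move: rxb rcb; rewrite (vA _ _ _ _ cfxd); do 3!case: (R _ _).
case Tcy: (twisted R a b c y).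
  have /and5P[_ ecb eay rcb ray] := Tcy.
  have /and5P[_ esb ead rsb rad] := twistedW nab cfcy Tcy.
  apply: (T0F a y s b) => //; last by rewrite eq_sym.
  by move: ray rad; rewrite (vA _ _ _ _ cfcy); do 3!case: (R _ _).
move: cxd ccy; rewrite /flip Txd Tcy !addbF.
case Txy: (twisted R a b x y); last first.
  by rewrite addbF => cxd ccy; apply: (T0F _ _ _ _ cf).
(* Among [xy], [xd], [cy] only [xy] changed, so all three had the same colour before, opposite to
   [xb] and [ay]. The colour of [cb] decides: if it differs from that of [xb], then [xb] was
   twisted, otherwise [ay] was. *)
rewrite addbT => cxd ccy.
have /and5P[_ exb eay rxb ray] := Txy.
have /and5P[_ esb eaw rsb raw] := twistedW nab cf Txy.
have rxd := vA _ _ _ _ cfxd; have rcy := vA _ _ _ _ cfcy.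
have ecb : E c b.
  by apply: (same_colour exb ecw) => //; move: rxb cxd; rewrite rxd; do 3!case: (R _ _).
have ead : E a d.
  by apply: (same_colour esd eay) => //; move: ray ccy; rewrite rcy; do 3!case: (R _ _).
have /vA rcb : conflicts c b a d by [].
case: (eqVneq (R c b) (R x b)) => [ecx | ncx]; last first.
  by apply: (T0F x b a w) => //; move: rxb cxd; do 3!case: (R _ _).
apply: (T0F a y s b) => //; last by move: ray ccy; do 3!case: (R _ _).
by move: ecx ray rxb; rewrite rcb; do 4!case: (R _ _).
Qed.

End Valid.

Lemma untwisted_valid R0 : valid R0 ->
  exists2 R, valid R & forall a b, ~~ E a b -> forall x y, ~~ twisted R a b x y.
Proof.
move=> vR0.
suff [R vR T0] : exists2 R, valid R & forall a b, (a, b) \in enum {: U * V} ->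
    ~~ E a b -> forall x y, ~~ twisted R a b x y.
  by exists R => // a b; apply: T0; rewrite mem_enum.
elim: (enum _) => [|[a b] s [R vR T0]]; first by exists R0.
case: (boolP (E a b)) => [eab | nab].
  by exists R => // c d; rewrite inE => /predU1P[[-> ->] | /T0 //]; rewrite eab.
exists (flip R a b) => [|c d]; first exact: flip_valid.
rewrite inE => /predU1P[[-> ->] _ x y | /T0 T0cd ncd]; first exact: flip_untwisted.
by apply: flip_stays_untwisted => //; apply: T0cd.
Qed.

(** * Alternating walks in an untwisted colouring *)

Section Walks.
Variable R : U -> V -> bool.
Hypothesis vR : valid R.
Hypothesis R_untwisted : forall a b, ~~ E a b -> forall x y, ~~ twisted R a b x y.

(* [walk c n u v]: an alternating walk from [u] to [v] using [n.+1] edges of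
   colour [c] ([true] is red) and [n] non-edges. *)
Inductive walk (c : bool) : nat -> U -> V -> Prop :=
| walk0 u v of E u v & R u v = c : walk c 0 u v
| walkS n u v u' v' of E u v & R u v = c & ~~ E u' v & walk c n u' v' :
    walk c n.+1 u v'.

(** The chords [u2 v3], [u1 v2], [u3 v1] are forced to be edges, and [u2 v2] would be twisted at the
    non-edge [(u1, v3)]. *)
Lemma no_alternating_hexagon u1 v1 u2 v2 u3 v3 :
  E u1 v1 -> E u2 v2 -> E u3 v3 -> R u1 v1 = R u2 v2 -> R u2 v2 = R u3 v3 ->
  ~~ E u2 v1 -> ~~ E u3 v2 -> ~~ E u1 v3 -> False.
Proof.
move=> e1 e2 e3 r12 r23 n21 n32 n13.
have e23 : E u2 v3 := same_colour vR e3 e2 (esym r23) n32.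
have e12 : E u1 v2 := same_colour vR e2 e1 (esym r12) n21.
have e31 : E u3 v1 := same_colour vR e1 e3 (etrans r12 r23) n13.
have /negP[] := R_untwisted n13 u2 v2; apply/and5P; split=> //.
- by apply: (@conflictsW _ _ u3 v1).
- have /(valid_A vR)-> : conflicts u2 v3 u1 v1 by [].
  by rewrite r12; case: (R _ _).
- have /(valid_A vR)-> : conflicts u1 v2 u3 v3 by [].
  by rewrite r23; case: (R _ _).
Qed.

(** No walk closes up at a non-edge. In a shortest failure [u1 v2] conflicts with [u3 y]: either
    [u1 v2] has colour [c] and shortens the walk, or [u3 y] has it and closes a hexagon. *)
Lemma walk_edge c n u v : walk c n u v -> E u v.
Proof.
elim/ltn_ind: n u v => n IHn u v W; apply: contraT => nuv.
case: W IHn nuv => [w y -> // | m u1 v1 u2 y e1 r1 n21 W].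
case: W n21 => {m u2 y} [u2 v2 e2 r2 n21 _ n12 | m u2 v2 u3 y e2 r2 n32 W n21 IHn n1y].
  by move: n12; rewrite (same_colour vR e2 e1) ?r1 ?r2.
have e12 : E u1 v2 by apply: (same_colour vR e2 e1); rewrite ?r1 ?r2.
have e3y : E u3 y by apply: IHn W.
have /(valid_A vR) r12 : conflicts u1 v2 u3 y by [].
case: (eqVneq (R u1 v2) c) => [r | r].
  by case/negP: n1y; apply: (IHn m.+1) => //; apply: walkS n32 W.
have r3y : R u3 y = c by move: r; rewrite r12; case: (R _ _); case: (c).
by case: (no_alternating_hexagon e1 e2 e3y); rewrite ?r1 ?r2 ?r3y.
Qed.

Definition linked c u v := exists n, walk c n u v.

Lemma linked1 c u v : E u v -> R u v = c -> linked c u v.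
Proof. by move=> e r; exists 0; apply: walk0. Qed.

Lemma linked_cons c u v u' v' :
  E u v -> R u v = c -> ~~ E u' v -> linked c u' v' -> linked c u v'.
Proof. by move=> e r n [k W]; exists k.+1; apply: walkS e r n W. Qed.

Lemma linked_nonedge c u1 v1 u2 v2 :
  linked c u1 v1 -> ~~ E u2 v1 -> linked c u2 v2 -> linked c u1 v2.
Proof.
case=> n W; elim: n u1 v1 / W => [u v e r|n u v u' v' e r n' W IH] nE L.
  exact: (linked_cons e r nE L).
by apply: (linked_cons e r n'); apply: IH.
Qed.

(** The detour comes from blue conflict partners [xy] and [x'y'] of the two red edges. Either one of
    [u1 v2], [xy'], [u1 y'], [x v2] is red and gives a walk, or [u1 v2] and [x'y'] are blue and in
    conflict. *)
Lemma red_F_step u1 v1 u2 v2 :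
  R u1 v1 -> F u2 v1 -> R u2 v2 -> linked true u1 v2.
Proof.
move=> R1 F21 R2; have vA := valid_A vR; have vC := valid_C vR.
have e1 := valid_edge vR R1; have e2 := valid_edge vR R2.
have link u v : R u v -> linked true u v.
  by move=> Ruv; apply: linked1 => //; apply: valid_edge Ruv.
have e12 : E u1 v2 by apply: contraT => n12; case: (vC _ _ _ _ R1 R2 n12 F21).
case: (boolP (R u1 v2)) => [/link //|r12].
have /has_conflictP[x [y cf1]] := valid_conflict vR R1.
have /has_conflictP[x' [y' cf2]] := valid_conflict vR R2.
have [_ exy n1y nx1] := cf1; have [_ ex'y' n2y' nx'2] := cf2.
have rxy : R x y = false by move/conflicts_sym/vA: cf1; rewrite R1.
have rx'y' : R x' y' = false by move/conflicts_sym/vA: cf2; rewrite R2.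
case: (boolP (E x y')) => [exy' | nxy'].
  have /vA Rxy' : conflicts x y' u2 v1 by split=> //; apply: sFE.
  rewrite (negPf (valid_F vR F21)) in Rxy'.
  by apply: (linked_cons e1 R1 nx1); apply: (linked_cons exy' Rxy' n2y'); apply: link.
have ex'y : E x' y by apply: (same_colour vR exy ex'y'); rewrite ?rxy ?rx'y'.
have Rx'y : R x' y.
  have /vA : conflicts x' y u1 v2 by [].
  by rewrite (negPf r12).
have e2y : E u2 y by apply: (same_colour vR ex'y e2); rewrite ?Rx'y ?R2.
have ex'1 : E x' v1 by apply: (same_colour vR e1 ex'y); rewrite ?Rx'y ?R1.
case: (boolP (E u1 y')) => [e1y' | n1y'].
  have /vA R1y' : conflicts u1 y' u2 y by [].
  have r2y : ~~ R u2 y by apply/negP => R2y; apply: vC R1 R2y n1y F21.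
  by rewrite r2y in R1y'; apply: (linked_cons e1y' R1y' n2y'); apply: link.
case: (boolP (E x v2)) => [ex2 | nx2].
  have /vA Rx2 : conflicts x v2 x' v1 by [].
  have rx'1 : ~~ R x' v1 by apply/negP => Rx'1; apply: vC Rx'1 R2 nx'2 F21.
  by rewrite rx'1 in Rx2; apply: (linked_cons e1 R1 nx1); apply: link.
have /vA : conflicts u1 v2 x' y' by [].
by rewrite (negPf r12) rx'y'.
Qed.

Lemma red_linked_comp u1 v1 u2 v2 : linked true u1 v1 ->
  ~~ E u2 v1 || F u2 v1 -> linked true u2 v2 -> linked true u1 v2.
Proof.
move=> L1 /orP[n21 | F21 L2]; first exact: (linked_nonedge L1 n21).
(* The induction isolates the last red edge before [F]; the case analysis on [L2] isolates the first
   one after it. *)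
case: L1 => n W; elim: n u1 v1 / W F21 => [u v e r F21|n u v u' v' e r n' W IH F21].
  case: L2 => m W; case: W F21 => [w y _ r' F21|k w y w' y' _ r' n' W F21].
    exact: (red_F_step r F21 r').
  by apply: linked_nonedge n' _; [apply: (red_F_step r F21 r') | exists k].
by apply: (linked_cons e r n'); apply: IH.
Qed.

Lemma red_linked_disj u v : linked true u v -> ~~ E u v || F u v -> False.
Proof.
move=> L /orP[/negP[] | Fuv]; first by case: L => n; apply: walk_edge.
case: L => n W; case: W Fuv => [u0 v0 _ r F0 | k u0 y w v0 e r nwy W F0].
  by move: (valid_F vR F0); rewrite r.
(* Rotate the closed walk so that it closes up at the non-edge [(w, y)]. *)
have [m] : linked true w y.
  apply: (@red_linked_comp w v0 u0 y); rewrite ?F0 ?orbT //; first by exists k.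
  exact: linked1.
by move/walk_edge; apply/negP.
Qed.

(** Red and blue together exhaust [E], uncommitted edges being blue, so extending each class
    separately yields a cover. *)
Lemma untwisted_cover : exists E1 E2 : {set U * V},
  [/\ chain_graph E1, chain_graph E2,
      forall u v, (u, v) \in E1 -> E u v && ~~ F u v,
      forall u v, (u, v) \in E2 -> E u v
    & forall u v, E u v -> ((u, v) \in E1) || ((u, v) \in E2)].
Proof.
have [u v Ruv|||E1 [ch1 sR1 N1]] :=
  @chain_extension U V R (fun u v => ~~ E u v || F u v) (linked true).
- exact: linked1 (valid_edge vR Ruv) Ruv.
- exact: red_linked_comp.
- exact: red_linked_disj.
have [u v /andP[]||u v|E2 [ch2 sB2 N2]] := @chain_extension U V
  (fun u v => E u v && (R u v == false)) (fun u v => ~~ E u v) (linked false).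
- by move=> Euv /eqP; apply: linked1.
- exact: linked_nonedge.
- by case=> n /walk_edge ->.
exists E1, E2; split=> // u v.
- by move/N1; rewrite negb_or negbK.
- by move/N2; rewrite negbK.
- by move=> Euv; case Ruv: (R u v); [rewrite sR1 | rewrite sB2 ?orbT // Euv Ruv].
Qed.

End Walks.

End Colouring.

(** * Translation between bipartitions, colourings and covers *)

Lemma committedP (U V : finType) (E : {set U * V}) u v :
  ((u, v) \in committed E) = has_conflict (fun u v => (u, v) \in E) u v.
Proof.
rewrite inE; apply/andP/has_conflictP => [[Euv /existsP[[u' v']]]|[u' [v' [Euv E' n1 n2]]]].
  by case/and4P=> _ E' n1 n2; exists u', v'.
split=> //; apply/existsP; exists (u', v'); rewrite E' n1 n2 !andbT.
(* A conflict partner equal to [(u, v)] would make [(u, v')] an edge. *)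
by apply: contraNneq n1 => -[_ ->].
Qed.

Lemma valid_bipartition (U V : finType) (E F Er Eb : {set U * V}) :
  bipartition_Ec E F Er Eb -> AC_free E F Er Eb ->
  valid (fun u v => (u, v) \in E) (fun u v => (u, v) \in F)
        (fun u v => (u, v) \in Er).
Proof.
case=> disj cover sFb AC.
have mem_c u v : ((u, v) \in committed E) = ((u, v) \in Er) || ((u, v) \in Eb).
  by rewrite -cover inE.
have rb u v : (u, v) \in Er -> (u, v) \in Eb -> False.
  by move=> r b; have := in_set0 (u, v); rewrite -disj inE r b.
split=> [u v r|u1 v1 u2 v2 cf|u v f|u1 v1 u2 v2 r1 r2 n12 f21].
- by rewrite -committedP mem_c r.
- have [_ _ n12 n21] := cf; have [A1 A2 _] := AC u1 u2 v1 v2.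
  have := conflictsW cf; rewrite -committedP mem_c.
  have := conflictsW (conflicts_sym cf); rewrite -committedP mem_c.
  case r1: ((u1, v1) \in Er); case r2: ((u2, v2) \in Er) => //= b2 b1.
    by case: A1; split; rewrite ?inE.
  by case: A2; split; rewrite ?inE.
- apply/negP => r; apply: (rb _ _ r); apply: (subsetP sFb).
  by rewrite inE f mem_c r.
- by have [_ _ []] := AC u1 u2 v1 v2; split; rewrite ?inE.
Qed.

(** Committed edges outside [E1] lie in [E2]. As [F] misses [E1], both (A1) and (C) would be an
    induced 2K2 of [E1], and (A2) one of [E2]. *)
Lemma cover_bipartition (U V : finType) (E F E1 E2 : {set U * V}) :
  two_chain_cover E E1 E2 -> E1 :&: F = set0 ->
  let Er := committed E :&: E1 in let Eb := committed E :\: E1 in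
  bipartition_Ec E F Er Eb /\ AC_free E F Er Eb.
Proof.
case=> sE1 sE2 ch1 ch2 cover disj /=.
have notF e : e \in F -> e \notin E1.
  by move=> f; apply/negP => e1; have := in_set0 e; rewrite -disj inE e1 f.
have notE1 e : e \notin E -> e \notin E1 by apply: contra; apply: (subsetP sE1).
have notE2 e : e \notin E -> e \notin E2 by apply: contra; apply: (subsetP sE2).
have inE2 e : e \in committed E -> e \notin E1 -> e \in E2.
  by rewrite inE -{1}cover inE => /andP[/orP[-> //|]].
split.
  split; [by apply/setP => e; rewrite !inE; case: (e \in E1); rewrite ?andbF |
    exact: setID | apply/subsetP => e].
  by rewrite in_setI in_setD => /andP[/notF -> ->].
move=> u1 u2 v1 v2; split=> -[]; rewrite ?in_setI ?in_setD.
- case/andP=> _ e1 /andP[_ e2]; rewrite !in_setC => n12 n21.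
  by case: ch1; exists u1, u2, v1, v2; split=> //; apply: notE1.
- case/andP=> n1 c1 /andP[n2 c2]; rewrite !in_setC => n12 n21.
  by case: ch2; exists u1, u2, v1, v2; split; [exact: inE2 | exact: inE2 | exact: notE2 | exact: notE2].
- case/andP=> _ e1 /andP[_ e2]; rewrite in_setC => n12 f21.
  by case: ch1; exists u1, u2, v1, v2; split=> //; [apply: notE1 | apply: notF].
Qed.

Theorem theorem4 (U V : finType) (E F : {set U * V}) (HF : F \subset E) :
  (exists E1 E2 : {set U * V}, two_chain_cover E E1 E2 /\ E1 :&: F = set0) <->
  (exists Er Eb : {set U * V}, bipartition_Ec E F Er Eb /\ AC_free E F Er Eb).
Proof.
split=> [[E1 [E2 [cover disj]]]|[Er [Eb [bip AC]]]].
  by exists (committed E :&: E1), (committed E :\: E1); apply: cover_bipartition cover disj.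
(* The cover extends the recoloured [R], so [E1] need not contain [Er]. *)
have [R vR R_untwisted] := untwisted_valid (valid_bipartition bip AC).
have sFE u v : (u, v) \in F -> (u, v) \in E by apply: (subsetP HF).
have [E1 [E2 [ch1 ch2 s1 s2 cover]]] := untwisted_cover sFE vR R_untwisted.
exists E1, E2; split.
  split=> //; first by apply/subsetP => -[u v] /s1 /andP[].
    by apply/subsetP => -[u v] /s2.
  apply/setP => -[u v]; rewrite inE; apply/orP/idP => [[/s1 /andP[]|/s2] // |].
  by move/cover/orP.
apply/setP => -[u v]; rewrite !inE; apply/andP => -[/s1 /andP[_ /negP]].
by [].
Qed.
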